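(* Let $\mathcal M$ and $\mathcal N=\{N^{(\lambda)}:\lambda\in\mathbb R_{>0}\}$ be two quasianalytic weight matrices and assume $\sup_{k\in\mathbb N_{>0}}(n^{(\lambda)}_k)^{1/k}=+\infty$ for all $\lambda>0$ (Roumieu case) resp. $\lim_{k\to+\infty}(n^{(\lambda)}_k)^{1/k}=+\infty$ for all $\lambda>0$ (Beurling case). Then $\Lambda^r_{[\mathcal N]}\setminus j^\infty(\mathcal E^{0,r}_{\{\mathcal M\}})$ is lineable in $\Lambda^r_{[\mathcal N]}$ (and hence so is $\Lambda^r_{[\mathcal N]}\setminus j^\infty(\mathcal E^{0,r}_{(\mathcal M)})$).
   Context: For a sequence $M=(M_p)_{p\in\mathbb N}$ of positive reals write $m_p:=M_p/p!$. $M$ is a weight sequence if $1=M_0\le M_1$, $M_p^2\le M_{p-1}M_{p+1}$ for all $p\ge1$, and $\liminf_{p\to\infty}m_p^{1/p}>0$; it is quasianalytic if $\sum_{p\ge1}M_{p-1}/M_p=+\infty$. A weight matrix is a family $\mathcal M=\{M^{(\lambda)}:\lambda\in\mathbb R_{>0}\}$ of weight sequences with $M^{(\lambda)}_p\le M^{(\kappa)}_p$ for all $p$ whenever $\lambda\le\kappa$; write $n^{(\lambda)}_p:=N^{(\lambda)}_p/p!$. It is quasianalytic if every member is quasianalytic. For $U\subseteq\mathbb R^r$ open, $K\subseteq U$ compact, $h>0$: $\|f\|^M_{K,h}:=\sup_{\alpha\in\mathbb N^r,x\in K}|\partial^\alpha f(x)|/(h^{|\alpha|}M_{|\alpha|})$.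 $\mathcal E_{\{\mathcal M\}}(U)$: smooth $f$ such that for every compact $K\subseteq U$ there exist $\lambda>0$, $h>0$ with $\|f\|^{M^{(\lambda)}}_{K,h}<\infty$; $\mathcal E_{(\mathcal M)}(U)$: smooth $f$ with $\|f\|^{M^{(\lambda)}}_{K,h}<\infty$ for all compact $K$, all $\lambda>0$, all $h>0$. $\mathcal E^{0,r}_{\{\mathcal M\}}$, $\mathcal E^{0,r}_{(\mathcal M)}$ are the corresponding spaces of germs at $0\in\mathbb R^r$. For $\mathbf b=(b_\alpha)_{\alpha\in\mathbb N^r}$, a weight sequence $N$, $h>0$: $|\mathbf b|^N_h:=\sup_\alpha|b_\alpha|/(h^{|\alpha|}n_{|\alpha|})$; $\Lambda^r_{\{\mathcal N\}}:=\{\mathbf b:\exists\lambda>0\,\exists h>0,\ |\mathbf b|^{N^{(\lambda)}}_h<\infty\}$, $\Lambda^r_{(\mathcal N)}:=\{\mathbf b:\forall\lambda>0\,\forall h>0,\ |\mathbf b|^{N^{(\lambda)}}_h<\infty\}$. The Borel map is $j^\infty(f)=(\partial^\alpha f(0)/|\alpha|!)_{\alpha\in\mathbb N^r}$. $[\cdot]$ means $\{\cdot\}$ throughout or $(\cdot)$ throughout. A subset $L$ of a vector space $X$ is lineable if $L\cup\{0\}$ contains an infinite-dimensional vector subspace. *)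

(* Defs.v *)
From Stdlib Require Import Reals.
From mathcomp Require Import all_boot.
Set Implicit Arguments. Unset Strict Implicit.

Local Open Scope R_scope.

Definition point (r : nat) := 'I_r -> R.
Definition mindex (r : nat) := 'I_r -> nat.
Definition mseq (r : nat) := mindex r -> R.

Definition mlen (r : nat) (a : mindex r) : nat := (\sum_(i < r) a i)%N.
Definition msucc (r : nat) (a : mindex r) (i : 'I_r) : mindex r :=
  fun j => (a j + (if j == i then 1 else 0))%N.
Definition mzero (r : nat) : mindex r := fun _ => 0%N.
Definition origin (r : nat) : point r := fun _ => 0.
Definition upd (r : nat) (x : point r) (i : 'I_r) (t : R) : point r :=
  fun j => if j == i then t else x j.

Definition near (r : nat) (x y : point r) (d : R) : Prop :=
  forall j, Rabs (y j - x j) < d.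

Definition is_open (r : nat) (U : point r -> Prop) : Prop :=
  forall x, U x -> exists eps, 0 < eps /\ forall y, near x y eps -> U y.

Definition is_compact (r : nat) (K : point r -> Prop) : Prop :=
  forall (I : Type) (O : I -> point r -> Prop),
    (forall i, is_open (O i)) ->
    (forall x, K x -> exists i, O i x) ->
    exists l : list I, forall x, K x -> exists i, List.In i l /\ O i x.

(* D is the family of all partial derivatives of f on the open set U:
   D alpha = d^alpha f, each continuous on U; i.e. f is C^infinity on U. *)
Definition deriv_family (r : nat) (U : point r -> Prop) (f : point r -> R)
  (D : mindex r -> point r -> R) : Prop :=
  (forall x, U x -> D (@mzero r) x = f x) /\
  (forall a i x, U x ->
     derivable_pt_lim (fun t => D a (upd x i t)) (x i) (D (msucc a i) x)) /\
  (forall a x, U x -> forall eps, 0 < eps -> exists del, 0 < del /\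
     forall y, U y -> near x y del -> Rabs (D a y - D a x) < eps).

Definition proot (p : nat) (y : R) : R := Rpower y (/ INR p).
Definition small_m (M : nat -> R) (p : nat) : R := M p / INR (Factorial.fact p).

Definition weight_sequence (M : nat -> R) : Prop :=
  (forall p, 0 < M p) /\ M 0%nat = 1 /\ 1 <= M 1%nat /\
  (forall p, (1 <= p)%nat -> M p ^ 2 <= M (p - 1)%nat * M (S p)) /\
  (exists c, 0 < c /\ exists P, forall p, (P <= p)%nat -> (1 <= p)%nat ->
      c <= proot p (small_m M p)).

Definition quasianalytic (M : nat -> R) : Prop :=
  forall A, exists n, A < sum_f_R0 (fun k => M k / M (S k)) n.

Definition weight_matrix (M : R -> nat -> R) : Prop :=
  (forall l, 0 < l -> weight_sequence (M l)) /\
  (forall l k, 0 < l -> l <= k -> forall p, M l p <= M k p).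

Definition quasianalytic_matrix (M : R -> nat -> R) : Prop :=
  forall l, 0 < l -> quasianalytic (M l).

(* roumieu = true : {.}  ;  roumieu = false : (.) *)
Definition growth_condition (roumieu : bool) (N : R -> nat -> R) : Prop :=
  if roumieu then
    forall l, 0 < l -> forall A, exists k, (1 <= k)%nat /\
       A < proot k (small_m (N l) k)
  else
    forall l, 0 < l -> forall A, exists K, forall k, (K <= k)%nat -> (1 <= k)%nat ->
       A < proot k (small_m (N l) k).

Definition Lambda (roumieu : bool) (r : nat) (N : R -> nat -> R) (b : mseq r) : Prop :=
  if roumieu then
    exists l h C, 0 < l /\ 0 < h /\ forall a,
      Rabs (b a) <= C * (h ^ mlen a * small_m (N l) (mlen a))
  else
    forall l h, 0 < l -> 0 < h -> exists C, forall a,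
      Rabs (b a) <= C * (h ^ mlen a * small_m (N l) (mlen a)).

Definition norm_finite (r : nat) (D : mindex r -> point r -> R) (K : point r -> Prop)
  (M : nat -> R) (h : R) : Prop :=
  exists C, forall a x, K x -> Rabs (D a x) <= C * (h ^ mlen a * M (mlen a)).

Definition in_E (roumieu : bool) (r : nat) (M : R -> nat -> R) (U : point r -> Prop)
  (f : point r -> R) : Prop :=
  exists D, deriv_family U f D /\
  forall K, is_compact K -> (forall x, K x -> U x) ->
   if roumieu then exists l h, 0 < l /\ 0 < h /\ norm_finite D K (M l) h
   else forall l h, 0 < l -> 0 < h -> norm_finite D K (M l) h.

(* b belongs to j^infty(E^{0,r}_[M]) : b is the (|alpha|!-normalised) jet at 0 of
   a representative of a germ in E^{0,r}_[M] *)
Definition jet_image (roumieu : bool) (r : nat) (M : R -> nat -> R) (b : mseq r) : Prop :=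
  exists (U : point r -> Prop) (f : point r -> R) (D : mindex r -> point r -> R),
    is_open U /\ U (@origin r) /\ deriv_family U f D /\
    (forall K, is_compact K -> (forall x, K x -> U x) ->
       if roumieu then exists l h, 0 < l /\ 0 < h /\ norm_finite D K (M l) h
       else forall l h, 0 < l -> 0 < h -> norm_finite D K (M l) h) /\
    forall a, b a = D a (@origin r) / INR (Factorial.fact (mlen a)).

(* L is lineable in X: L u {0} contains an infinite-dimensional vector subspace
   V of X (infinite-dimensional = contains a linearly independent sequence) *)
Definition lineable_in (r : nat) (X L : mseq r -> Prop) : Prop :=
  exists V : mseq r -> Prop,
    V (fun _ => 0) /\
    (forall u v, V u -> V v -> V (fun a => u a + v a)) /\
    (forall c u, V u -> V (fun a => c * u a)) /\
    (forall u, V u -> X u) /\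
    (exists e : nat -> mseq r, (forall n, V (e n)) /\
       forall n (c : nat -> R),
         (forall a, sum_f_R0 (fun i => c i * e i a) n = 0) ->
         forall i, (i <= n)%nat -> c i = 0) /\
    (forall u, V u -> u = (fun _ => 0) \/ L u).

Arguments Lambda roumieu r N b : clear implicits.
Arguments jet_image roumieu r M b : clear implicits.

(* Main.v *)
Require Import Defs.
From Stdlib Require Import Reals Ranalysis5 Lra Lia.
From Stdlib Require Import ClassicalEpsilon FunctionalExtensionality.
From mathcomp Require Import all_boot zify.
Local Open Scope R_scope.

(** Restricted to a coordinate axis, a function of the quasianalytic class all
    of whose derivatives of order at least [K] are positive at [0] has these
    derivatives nonnegative on some [[0, d]] (Bang), and is therefore real
    analytic at [0] (Bernstein): the Taylor coefficients of its jet grow at most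
    exponentially.  Now choose a positive sequence [beta] in the target sequence
    space that is not bounded by any geometric sequence, and consider the jets
    [b_alpha = P (2 ^ (- |alpha|)) * beta_|alpha|] with [P] a polynomial.  If
    [P <> 0], its term of lowest degree fixes the sign of [b_alpha] for large
    [|alpha|] and costs only a geometric factor, so [b] is not a jet of the
    class. *)

(** * Comparison of functions through their derivatives *)

Lemma nonneg_derivative_le (f f' : R -> R) (a b : R) :
  a <= b ->
  (forall t, a <= t <= b -> derivable_pt_lim f t (f' t)) ->
  (forall t, a <= t <= b -> 0 <= f' t) ->
  f a <= f b.
Proof.
intros [ab|<-] Hd Hp; [|lra].
destruct (MVT_cor2 f f' a b ab Hd) as [c [Hc Hcab]].
assert (0 <= f' c) by (apply Hp; lra).
nra.
Qed.

(** Both [G - f] and [G + f] are nondecreasing on the interval and nonnegative at [a]. *)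
Lemma Rabs_le_of_derivative (f f' G G' : R -> R) (a b : R) :
  a <= b ->
  (forall t, a <= t <= b -> derivable_pt_lim f t (f' t)) ->
  (forall t, a <= t <= b -> derivable_pt_lim G t (G' t)) ->
  (forall t, a <= t <= b -> Rabs (f' t) <= G' t) ->
  Rabs (f a) <= G a ->
  Rabs (f b) <= G b.
Proof.
intros ab Hf HG Hd Ha.
assert (H1 := @nonneg_derivative_le (fun t => G t - f t) (fun t => G' t - f' t)
  a b ab).
assert (H2 := @nonneg_derivative_le (fun t => G t + f t) (fun t => G' t + f' t)
  a b ab).
cbv beta in H1, H2.
assert (G a - f a <= G b - f b).
{ apply H1; intros t Ht.
  - exact (derivable_pt_lim_minus G f t _ _ (HG t Ht) (Hf t Ht)).
  - assert (H := Hd t Ht); assert (H' := Rle_abs (f' t)); lra. }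
assert (G a + f a <= G b + f b).
{ apply H2; intros t Ht.
  - exact (derivable_pt_lim_plus G f t _ _ (HG t Ht) (Hf t Ht)).
  - assert (H' := Hd t Ht); assert (H'' := Rle_abs (- f' t)).
    rewrite Rabs_Ropp in H''; lra. }
assert (H' := Rle_abs (f a)); assert (H'' := Rle_abs (- f a)).
rewrite Rabs_Ropp in H''.
apply Rabs_le; lra.
Qed.

Lemma exp_le_compat (a b : R) : a <= b -> exp a <= exp b.
Proof. intros [ab| ->]; [apply Rlt_le, exp_increasing; exact ab|lra]. Qed.

(** * Bang's theorem on zeros of successive derivatives *)

Definition derivative_tower (g : nat -> R -> R) (d : R) : Prop :=
  forall n t, 0 <= t <= d -> derivable_pt_lim (g n) t (g n.+1 t).

(** For positive [W] this is log-convexity, written without division and for arbitrary pairs of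
    indices rather than neighbours. *)
Definition ratio_increasing (W : nat -> R) : Prop :=
  forall n m, (n <= m)%N -> W n.+1 * W m <= W m.+1 * W n.

(** Divergence is asked of every tail because the descent below starts at an arbitrary flatness
    level [m]. *)
Definition ratio_sum_diverges (W : nat -> R) : Prop :=
  forall m A, exists k, A < sum_f_R0 (fun i => W (m + i)%N / W (m + i).+1) k.

Section Bang.

Variables (g : nat -> R -> R) (d : R) (W x : nat -> R).
Hypothesis gD : derivative_tower g d.
Hypothesis g_le : forall n t, 0 <= t <= d -> Rabs (g n t) <= W n.
Hypothesis W_gt0 : forall n, 0 < W n.
Hypothesis W_ratio : ratio_increasing W.
Hypothesis W_div : ratio_sum_diverges W.
Hypothesis x_gt0 : forall n, 0 < x n.
Hypothesis x_decr : forall n, x n.+1 <= x n.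
Hypothesis gx0 : forall n, g n (x n) = 0.

(* Bang's degree of flatness: at [z] only the derivatives whose chosen zero
   lies to the left of [z] are taken into account. *)
Definition flat (z A : R) : Prop :=
  forall n, x n <= z -> Rabs (g n z) <= A * exp (INR n) * W n.

(** Downward induction on the order [n]: above [m] the a priori bound [W n] is good enough, and a
    bound on [g n.+1] integrates to one on [g n]. *)
Lemma flat_transport (m : nat) (A z w : R) :
  exp (- INR m.+1) <= A -> 0 <= z -> z <= w -> w <= d ->
  flat z A -> flat w (A * exp (exp 1 * (W m.+1 / W m) * (w - z))).
Proof.
intros HA z0 zw wd Hz.
(* In passing from order [n] to [n.+1] the bound gains a factor [exp 1] from [exp (INR n)] and, for
   [n <= m], at most [W m.+1 / W m] from the weights; [c] is the product. *)
set (c := exp 1 * (W m.+1 / W m)).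
assert (c0 : 0 < c).
{ apply Rmult_lt_0_compat; [apply exp_pos|].
  apply Rdiv_lt_0_compat; apply W_gt0. }
assert (A0 : 0 < A) by (assert (H := exp_pos (- INR m.+1)); lra).
assert (key : forall k n, (m.+1 <= n + k)%N -> forall v, z <= v -> v <= d ->
  x n <= v -> Rabs (g n v) <= A * exp (c * (v - z)) * exp (INR n) * W n).
(* Here [A * exp (INR n) >= 1], so the bound follows from [g_le]. *)
{ assert (big : forall n, (m.+1 <= n)%N -> forall v, z <= v -> v <= d ->
    Rabs (g n v) <= A * exp (c * (v - z)) * exp (INR n) * W n).
  { intros n mn v zv vd.
    apply Rle_trans with (1 * W n); [rewrite Rmult_1_l; apply g_le; lra|].
    apply Rmult_le_compat_r; [apply Rlt_le, W_gt0|].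
    assert (1 <= exp (c * (v - z))).
    { rewrite <- exp_0; apply exp_le_compat; nra. }
    assert (1 <= A * exp (INR n)).
    { apply Rle_trans with (exp (- INR m.+1) * exp (INR n)).
      - rewrite <- exp_plus; rewrite <- exp_0; apply exp_le_compat.
        assert (INR m.+1 <= INR n) by (apply le_INR; lia). lra.
      - apply Rmult_le_compat_r; [apply Rlt_le, exp_pos|exact HA]. }
    replace (A * exp (c * (v - z)) * exp (INR n)) with
      ((A * exp (INR n)) * exp (c * (v - z))) by ring.
    nra. }
  induction k as [|k IH]; intros n mn v zv vd xv.
  { apply big; [lia|lra|lra]. }
  destruct (leqP m.+1 n) as [nm|nm]; [apply big; [exact nm|lra|lra]|].
  pose (B := A * exp (INR n) * W n).
  assert (B0 : 0 < B).
  { unfold B; apply Rmult_lt_0_compat; [|apply W_gt0].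
    apply Rmult_lt_0_compat; [exact A0|apply exp_pos]. }
  (* Integration starts at the later of [z] and [x n]: at [z] the flatness hypothesis gives the
     initial bound, at [x n] the function [g n] vanishes. *)
  set (p := Rmax z (x n)).
  assert (zp : z <= p) by apply Rmax_l.
  assert (xp : x n <= p) by apply Rmax_r.
  assert (pv : p <= v) by (apply Rmax_lub; assumption).
  replace (A * exp (c * (v - z)) * exp (INR n) * W n) with
    (B * exp (c * (v - z))) by (unfold B; ring).
  apply (@Rabs_le_of_derivative (g n) (g n.+1) (fun t => B * exp (c * (t - z)))
    (fun t => B * (exp (c * (t - z)) * c)) p v pv).
  - intros t Ht; apply gD; lra.
  - intros t Ht.
    apply derivable_pt_lim_scal.
    apply (derivable_pt_lim_comp (fun t => c * (t - z)) exp).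
    + assert (Ec : c = c * (1 - 0)) by ring.
      rewrite {2}Ec.
      apply derivable_pt_lim_scal.
      apply (derivable_pt_lim_minus id (fct_cte z));
        [apply derivable_pt_lim_id|apply derivable_pt_lim_const].
    + apply derivable_pt_lim_exp.
  - intros t Ht.
    (* Since the zeros decrease, [x n.+1 <= t] as well, so the induction hypothesis applies to order
       [n.+1]. *)
    assert (xn1 := x_decr n).
    assert (H := IH n.+1 ltac:(lia) t ltac:(lra) ltac:(lra) ltac:(lra)).
    apply Rle_trans with (1 := H).
    replace (B * (exp (c * (t - z)) * c)) with
      (A * exp (c * (t - z)) * exp (INR n) * exp 1 * (W m.+1 / W m * W n))
      by (unfold B, c; ring).
    rewrite S_INR exp_plus.
    replace (A * exp (c * (t - z)) * (exp (INR n) * exp 1) * W n.+1) with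
      (A * exp (c * (t - z)) * exp (INR n) * exp 1 * W n.+1) by ring.
    apply Rmult_le_compat_l.
    { assert (H1 := exp_pos (c * (t - z))). assert (H2 := exp_pos (INR n)).
      assert (H3 := exp_pos 1).
      repeat apply Rmult_le_pos; lra. }
    assert (Hr := W_ratio n m ltac:(lia)).
    assert (Hm := W_gt0 m).
    apply Rmult_le_reg_r with (W m); [exact Hm|].
    replace (W m.+1 / W m * W n * W m) with (W m.+1 * W n) by (field; lra).
    exact Hr.
  - unfold p, Rmax; destruct (Rle_dec z (x n)) as [zx|xz].
    + rewrite gx0 Rabs_R0.
      apply Rmult_le_pos; [lra|apply Rlt_le, exp_pos].
    + replace (c * (z - z)) with 0 by ring. rewrite exp_0 Rmult_1_r.
      apply Hz; lra. }
intros n xn.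
apply (key m.+1 n ltac:(lia) w zw wd xn).
Qed.

(* Climbing from flatness level [m + 1] to level [m] costs a distance at least
   [W m / (e * W (m + 1))], and these distances have a divergent sum. *)
Lemma flat_step (m : nat) (y z : R) :
  0 <= y -> y <= z -> z <= d -> exp 1 * (z - y) <= W m / W m.+1 ->
  flat y (exp (- INR m.+1)) -> flat z (exp (- INR m)).
Proof.
intros y0 yz zd Hq Hy n xn.
assert (q0 : 0 < W m / W m.+1) by (apply Rdiv_lt_0_compat; apply W_gt0).
assert (H := @flat_transport m _ y z (Rle_refl _) y0 yz zd Hy n xn).
apply Rle_trans with (1 := H).
apply Rmult_le_compat_r; [apply Rlt_le, W_gt0|].
apply Rmult_le_compat_r; [apply Rlt_le, exp_pos|].
rewrite <- exp_plus; apply exp_le_compat; rewrite S_INR.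
replace (exp 1 * (W m.+1 / W m) * (z - y)) with
  (exp 1 * (z - y) * / (W m / W m.+1))
  by (field; split; apply Rgt_not_eq, W_gt0).
assert (Hi : exp 1 * (z - y) * / (W m / W m.+1)
  <= W m / W m.+1 * / (W m / W m.+1))
  by (apply Rmult_le_compat_r; [apply Rlt_le, Rinv_0_lt_compat|]; assumption).
rewrite Rinv_r in Hi; lra.
Qed.

(** Walking left from [z], each step raises the flatness level by one; if the available distances
    add up to at least [z], the walk reaches 0. *)
Lemma flat_descent (k m : nat) (z : R) :
  0 <= z -> z <= d ->
  exp 1 * z <= sum_f_R0 (fun i => W (m + i)%N / W (m + i).+1) k ->
  flat z (exp (- INR m)).
Proof.
assert (e0 := exp_pos 1).
revert m z; induction k as [|k IH]; intros m z z0 zd Hz.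
- simpl in Hz. rewrite addn0 in Hz.
  apply (@flat_step m 0); [lra|lra|lra|rewrite Rminus_0_r; exact Hz|].
  (* Flatness at 0 is vacuous, all the zeros being positive. *)
  intros n xn; assert (H := x_gt0 n); lra.
- rewrite decomp_sum in Hz; [|lia].
  simpl Init.Nat.pred in Hz.
  rewrite addn0 in Hz.
  assert (q0 : 0 < W m / W m.+1) by (apply Rdiv_lt_0_compat; apply W_gt0).
  set (q := W m / W m.+1) in *.
  assert (Hs : sum_f_R0 (fun i => W (m + i.+1)%N / W (m + i.+1).+1) k =
    sum_f_R0 (fun i => W (m.+1 + i)%N / W (m.+1 + i).+1) k).
  { apply PartSum.sum_eq; intros i _; rewrite addnS; reflexivity. }
  rewrite Hs in Hz.
  assert (s0 : 0 <= sum_f_R0 (fun i => W (m.+1 + i)%N / W (m.+1 + i).+1) k).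
  { apply cond_pos_sum; intros i; apply Rlt_le, Rdiv_lt_0_compat; apply W_gt0. }
  assert (eq : exp 1 * (q / exp 1) = q) by (field; lra).
  assert (qe : 0 < q / exp 1) by (apply Rdiv_lt_0_compat; assumption).
  (* The next point is the farthest one that [flat_step] allows, cut off at 0. *)
  assert (y0 : 0 <= Rmax 0 (z - q / exp 1)) by apply Rmax_l.
  assert (yl : z - q / exp 1 <= Rmax 0 (z - q / exp 1)) by apply Rmax_r.
  assert (yz : Rmax 0 (z - q / exp 1) <= z) by (apply Rmax_lub; lra).
  apply (@flat_step m (Rmax 0 (z - q / exp 1)));
    [exact y0|exact yz|exact zd|fold q; nra|].
  apply IH; [exact y0|lra|].
  unfold Rmax; destruct (Rle_dec 0 (z - q / exp 1)); nra.
Qed.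

(** Divergence of all tails makes [w] flat of every level [m], so the value at [w] is at most
    [exp (- INR m) * W 0] for all [m]. *)
Lemma Bang_vanishing (w : R) : x 0%N <= w -> w <= d -> g 0%N w = 0.
Proof.
intros xw wd.
assert (xp := x_gt0 0%N).
destruct (Req_dec (g 0%N w) 0) as [e|ne]; [exact e|exfalso].
assert (gp : 0 < Rabs (g 0%N w)) by (apply Rabs_pos_lt; exact ne).
assert (W0 := W_gt0 0%N).
assert (q0 : 0 < Rabs (g 0%N w) / W 0%N) by (apply Rdiv_lt_0_compat; assumption).
destruct (INR_unbounded (- ln (Rabs (g 0%N w) / W 0%N))) as [m Hm].
destruct (W_div m (exp 1 * w)) as [k Hk].
assert (H := @flat_descent k m w ltac:(lra) wd ltac:(lra) 0%N xw).
rewrite exp_0 Rmult_1_r in H.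
assert (exp (- INR m) < exp (ln (Rabs (g 0%N w) / W 0%N)))
  by (apply exp_increasing; lra).
rewrite exp_ln in H0; [|exact q0].
assert (exp (- INR m) * W 0%N < Rabs (g 0%N w) / W 0%N * W 0%N)
  by (apply Rmult_lt_compat_r; assumption).
replace (Rabs (g 0%N w) / W 0%N * W 0%N) with (Rabs (g 0%N w)) in H1
  by (field; lra).
lra.
Qed.

End Bang.

(** * From positive derivatives at 0 to geometric bounds on Taylor coefficients *)

Lemma zero_before_negative (f f' : R -> R) (p : R) :
  0 < p -> (forall t, 0 <= t <= p -> derivable_pt_lim f t (f' t)) ->
  0 < f 0 -> f p < 0 -> exists q, 0 < q /\ q < p /\ f q = 0.
Proof.
intros p0 Hd f0 fp.
destruct (@IVT_interv (fun t => - f t) 0 p) as [q [Hq fq]]; [|lra|lra|lra|].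
{ intros a Ha. apply (continuity_pt_opp f).
  apply derivable_continuous_pt.
  exists (f' a). apply Hd; exact Ha. }
exists q.
assert (q <> 0) by (intros e; rewrite e in fq; lra).
assert (q <> p) by (intros e; rewrite e in fq; lra).
split; [lra|split; lra].
Qed.

(* A negative value of [g 0] would give, by repeated use of the mean value and
   intermediate value theorems, a decreasing sequence of zeros of the
   successive derivatives, which Bang's theorem excludes. *)
Lemma quasianalytic_nonneg_base (g : nat -> R -> R) (d : R) (W : nat -> R) :
  derivative_tower g d ->
  (forall n t, 0 <= t <= d -> Rabs (g n t) <= W n) ->
  (forall n, 0 < W n) -> ratio_increasing W -> ratio_sum_diverges W ->
  (forall n, 0 < g n 0) ->
  forall w, 0 <= w <= d -> 0 <= g 0%N w.
Proof.
intros gD g_le W0 Wr Wd g0 w Hw.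
destruct (Rle_lt_dec 0 (g 0%N w)) as [h|neg]; [exact h|exfalso].
assert (w0 : 0 < w).
{ destruct (proj1 Hw) as [h|e]; [exact h|].
  rewrite <- e in neg. assert (h := g0 0%N); lra. }
assert (zero : forall n p, 0 < p -> p <= d -> g n p < 0 ->
  exists q, 0 < q /\ q < p /\ g n q = 0).
{ intros n p p0 pd np.
  apply (@zero_before_negative (g n) (g n.+1)); [exact p0| |apply g0|exact np].
  intros t Ht; apply gD; lra. }
(* The requirements on the pair are made premises so that the choice function is total; off them the
   value is the dummy 0. *)
assert (next : forall np : nat * R, exists q,
  0 < np.2 -> np.2 <= d -> g np.1 np.2 = 0 ->
  0 < q /\ q < np.2 /\ g np.1.+1 q = 0).
{ intros [n p]; simpl.
  destruct (excluded_middle_informative (0 < p /\ p <= d /\ g n p = 0))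
    as [[p0 [pd gp]]|no]; [|exists 0; tauto].
  (* As [g n] falls from a positive value at 0 to zero at [p], its derivative is negative at some
     [c], and [zero] gives a zero of [g n.+1] before [c]. *)
  destruct (MVT_cor2 (g n) (g n.+1) 0 p p0) as [c [Hc Hcp]].
  { intros t Ht; apply gD; lra. }
  assert (gn := g0 n).
  destruct (zero n.+1 c) as [q [q0 [qc gq]]]; [lra|lra|nra|].
  exists q; intros; repeat split; lra. }
destruct (zero 0%N w w0 (proj2 Hw) neg) as [x0 [x0p [x0w gx0]]].
pose (F np := proj1_sig (constructive_indefinite_description _ (next np))).
assert (HF : forall n p, 0 < p -> p <= d -> g n p = 0 ->
  0 < F (n, p) /\ F (n, p) < p /\ g n.+1 (F (n, p)) = 0).
{ intros n p; unfold F.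
  destruct (constructive_indefinite_description _ (next (n, p))) as [q Hq].
  exact Hq. }
pose (x := nat_rect (fun _ => R) x0 (fun n p => F (n, p))).
assert (Hx : forall n, 0 < x n /\ x n <= d /\ g n (x n) = 0).
{ induction n as [|n [IH1 [IH2 IH3]]]; simpl; [repeat split; lra|].
  destruct (HF n (x n) IH1 IH2 IH3) as [h1 [h2 h3]].
  repeat split; [exact h1|lra|exact h3]. }
assert (E : g 0%N w = 0).
{ apply (@Bang_vanishing g d W x); try assumption.
  - intros n; apply Hx.
  - intros n. destruct (Hx n) as [h1 [h2 h3]].
    apply Rlt_le, (HF n (x n) h1 h2 h3).
  - intros n; apply Hx.
  - simpl; lra.
  - lra. }
lra.
Qed.

Lemma quasianalytic_nonneg (g : nat -> R -> R) (d : R) (W : nat -> R) (K : nat) :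
  derivative_tower g d ->
  (forall n t, 0 <= t <= d -> Rabs (g n t) <= W n) ->
  (forall n, 0 < W n) -> ratio_increasing W -> ratio_sum_diverges W ->
  (forall n, (K <= n)%N -> 0 < g n 0) ->
  forall j w, (K <= j)%N -> 0 <= w <= d -> 0 <= g j w.
Proof.
intros gD g_le W0 Wr Wd g0 j w Kj.
rewrite -(addn0 j).
apply (@quasianalytic_nonneg_base (fun n => g (j + n)%N) d (fun n => W (j + n)%N)).
- intros n t Ht. rewrite addnS. apply gD; exact Ht.
- intros n t Ht; apply g_le; exact Ht.
- intros n; apply W0.
- intros n m nm. rewrite !addnS. apply Wr; lia.
- intros m A. destruct (Wd (j + m)%N A) as [k Hk]. exists k.
  replace (sum_f_R0 _ k) with
    (sum_f_R0 (fun i => W (j + m + i)%N / W (j + m + i).+1) k); [exact Hk|].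
  apply PartSum.sum_eq; intros i _; rewrite !addnS !addnA; reflexivity.
- intros n; apply g0; lia.
Qed.

(* The Bernstein argument: Taylor's formula with nonnegative remainders. *)
Lemma absolutely_monotone_taylor (g : nat -> R -> R) (d : R) :
  derivative_tower g d ->
  (forall n t, 0 <= t <= d -> 0 <= g n t) ->
  forall n j t, 0 <= t <= d ->
  g (j + n)%N 0 * (t ^ n / INR (Factorial.fact n)) <= g j t.
Proof.
intros gD gp; induction n as [|n IH]; intros j t Ht.
- rewrite addn0. simpl.
  replace (g j 0 * (1 / 1)) with (g j 0) by field.
  apply (@nonneg_derivative_le (g j) (g j.+1)); [lra| |].
  + intros s Hs; apply gD; lra.
  + intros s Hs; apply gp; lra.
- set (C := g (j + n.+1)%N 0).
  assert (f1 : INR (Factorial.fact n.+1) <> 0) by apply INR_fact_neq_0.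
  assert (f2 : INR (Factorial.fact n) <> 0) by apply INR_fact_neq_0.
  (* After the top Taylor monomial is subtracted, the derivative is nonnegative by the induction
     hypothesis at [j.+1]. *)
  assert (H := @nonneg_derivative_le
    (fun s => g j s - C / INR (Factorial.fact n.+1) * s ^ n.+1)
    (fun s => g j.+1 s - C / INR (Factorial.fact n.+1) * (INR n.+1 * s ^ n)) 0 t).
  cbv beta in H.
  assert (H' : g j 0 - C / INR (Factorial.fact n.+1) * 0 ^ n.+1 <=
    g j t - C / INR (Factorial.fact n.+1) * t ^ n.+1).
  { apply H; [lra| |].
    - intros s Hs.
      apply (derivable_pt_lim_minus (g j)
        (fun s => C / INR (Factorial.fact n.+1) * s ^ n.+1)); [apply gD; lra|].
      apply derivable_pt_lim_scal. apply (derivable_pt_lim_pow s n.+1).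
    - intros s Hs.
      assert (E := IH j.+1 s ltac:(lra)).
      replace (j.+1 + n)%N with (j + n.+1)%N in E by lia.
      fold C in E.
      replace (C / INR (Factorial.fact n.+1) * (INR n.+1 * s ^ n)) with
        (C * (s ^ n / INR (Factorial.fact n))); [lra|].
      rewrite fact_simpl mult_INR.
      field. split; [exact f2|]. apply not_0_INR; lia. }
  assert (gj := gp j 0 ltac:(lra)).
  replace (C * (t ^ n.+1 / INR (Factorial.fact n.+1))) with
    (C / INR (Factorial.fact n.+1) * t ^ n.+1) by (field; exact f1).
  rewrite pow_ne_zero in H'; [lra|lia].
Qed.

(** Taylor's inequality at [t = d] for the tower shifted by [K] bounds
    [g n 0 * d ^ (n - K) / (n - K)!] by [g K d <= W K]; passing to [n!] only lowers the left
    side. *)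
Lemma quasianalytic_positive_jet_bound (g : nat -> R -> R) (d : R) (W : nat -> R) :
  0 < d -> derivative_tower g d ->
  (forall n t, 0 <= t <= d -> Rabs (g n t) <= W n) ->
  (forall n, 0 < W n) -> ratio_increasing W -> ratio_sum_diverges W ->
  forall K, (forall n, (K <= n)%N -> 0 < g n 0) ->
  forall n, (K <= n)%N ->
  g n 0 / INR (Factorial.fact n) <= (W K * d ^ K) * (/ d) ^ n.
Proof.
intros d0 gD g_le W0 Wr Wd K g0 n Kn.
assert (shD : derivative_tower (fun n => g (K + n)%N) d).
{ intros i t Ht. rewrite addnS. apply gD; exact Ht. }
assert (nonneg : forall j w, 0 <= w <= d -> 0 <= g (K + j)%N w).
{ intros j w. apply (@quasianalytic_nonneg g d W K); try assumption. lia. }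
assert (H := @absolutely_monotone_taylor _ d shD nonneg (n - K)%N 0%N d ltac:(lra)).
cbv beta in H. rewrite add0n addn0 in H.
replace (K + (n - K))%N with n in H by lia.
assert (HK := g_le K d ltac:(lra)).
assert (HK' := Rle_abs (g K d)).
assert (gn := g0 n Kn).
assert (fn := INR_fact_lt_0 n). assert (fnK := INR_fact_lt_0 (n - K)%N).
assert (ff : INR (Factorial.fact (n - K)) <= INR (Factorial.fact n))
  by (apply le_INR, Factorial.fact_le; lia).
assert (dn : 0 < d ^ (n - K)) by (apply pow_lt; exact d0).
assert (En : (W K * d ^ K) * (/ d) ^ n = W K / d ^ (n - K)).
{ rewrite pow_inv. replace n with (K + (n - K))%coq_nat at 1 by lia.
  rewrite pow_add. field.
  split; apply pow_nonzero; lra. }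
rewrite En.
apply Rle_trans with (g n 0 / INR (Factorial.fact (n - K))).
- apply Rmult_le_compat_l; [lra|]. apply Rinv_le_contravar; assumption.
- apply Rmult_le_reg_r with (d ^ (n - K)); [exact dn|].
  replace (W K / d ^ (n - K) * d ^ (n - K)) with (W K) by (field; lra).
  replace (g n 0 / INR (Factorial.fact (n - K)) * d ^ (n - K)) with
    (g n 0 * (d ^ (n - K) / INR (Factorial.fact (n - K)))) by (field; lra).
  lra.
Qed.

(** * Weight sequences as majorants for Bang's theorem *)

Lemma log_convex_ratio_increasing (M : nat -> R) :
  weight_sequence M -> ratio_increasing M.
Proof.
intros [M0 [_ [_ [lc _]]]] n m nm.
replace m with (n + (m - n))%N by lia.
induction (m - n)%N as [|k IH]; [rewrite addn0; lra|].
rewrite addnS. set (p := (n + k)%N) in *.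
assert (H := lc p.+1 ltac:(lia)).
replace (p.+1 - 1)%N with p in H by lia.
assert (hp := M0 p). assert (hn := M0 n). assert (hp1 := M0 p.+1).
apply Rmult_le_reg_r with (M p); [exact hp|].
apply Rle_trans with (M p.+1 ^ 2 * M n); nra.
Qed.

Lemma quasianalytic_ratio_sum_diverges (M : nat -> R) :
  (forall p, 0 < M p) -> quasianalytic M -> ratio_sum_diverges M.
Proof.
intros M0 qa m; induction m as [|m IH]; intros A.
- destruct (qa A) as [k Hk]. exists k. exact Hk.
- assert (q0 : 0 < M m / M m.+1) by (apply Rdiv_lt_0_compat; apply M0).
  (* The target includes the summand about to be dropped, and [Rmax A 0] keeps it at least as large
     as that summand, which excludes a one-term sum. *)
  destruct (IH (M m / M m.+1 + Rmax A 0)) as [[|k] Hk].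
  { exfalso. simpl in Hk. rewrite addn0 in Hk.
    assert (H := Rmax_r A 0); lra. }
  exists k. rewrite decomp_sum in Hk; [|lia].
  simpl Init.Nat.pred in Hk. rewrite addn0 in Hk.
  replace (sum_f_R0 _ k) with
    (sum_f_R0 (fun i => M (m + i.+1)%N / M (m + i.+1).+1) k).
  + assert (H := Rmax_l A 0); lra.
  + apply PartSum.sum_eq; intros i _; rewrite addnS; reflexivity.
Qed.

Lemma ratio_increasing_scale (M : nat -> R) (C h : R) :
  0 < C -> 0 < h ->
  ratio_increasing M -> ratio_increasing (fun k => C * (h ^ k * M k)).
Proof.
intros C0 h0 HM n m nm.
assert (H := HM n m nm).
replace (C * (h ^ n.+1 * M n.+1) * (C * (h ^ m * M m))) with
  ((C * C * h * h ^ n * h ^ m) * (M n.+1 * M m)) by (simpl; ring).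
replace (C * (h ^ m.+1 * M m.+1) * (C * (h ^ n * M n))) with
  ((C * C * h * h ^ n * h ^ m) * (M m.+1 * M n)) by (simpl; ring).
apply Rmult_le_compat_l; [|exact H].
assert (hn := pow_lt h n h0). assert (hm := pow_lt h m h0).
repeat apply Rmult_le_pos; lra.
Qed.

Lemma ratio_sum_diverges_scale (M : nat -> R) (C h : R) :
  0 < C -> 0 < h -> (forall p, 0 < M p) ->
  ratio_sum_diverges M -> ratio_sum_diverges (fun k => C * (h ^ k * M k)).
Proof.
intros C0 h0 M0 HM m A.
(* Scaling divides each ratio by [h], whence the target [h * A]. *)
destruct (HM m (h * A)) as [k Hk]. exists k.
replace (sum_f_R0 _ k) with
  (/ h * sum_f_R0 (fun i => M (m + i)%N / M (m + i).+1) k).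
- apply Rmult_lt_reg_l with h; [exact h0|].
  rewrite -Rmult_assoc Rinv_r; lra.
- rewrite scal_sum. apply PartSum.sum_eq; intros i _. cbv beta.
  simpl pow. set (p := (m + i)%N).
  assert (hp := pow_lt h p h0). assert (Mp := M0 p.+1).
  field. repeat split; lra.
Qed.

(** * Restriction to a coordinate axis *)

Definition axis {r : nat} (i : 'I_r) (t : R) : point r := upd (@origin r) i t.

Definition axis_index {r : nat} (i : 'I_r) (k : nat) : mindex r :=
  fun j => if j == i then k else 0%N.

Lemma axis0 (r : nat) (i : 'I_r) : axis i 0 = @origin r.
Proof.
apply functional_extensionality => j; rewrite /axis /upd /origin.
by case: (j == i).
Qed.

Lemma upd_axis (r : nat) (i : 'I_r) (s t : R) : upd (axis i s) i t = axis i t.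
Proof.
apply functional_extensionality => j; rewrite /axis /upd.
by case: (j == i).
Qed.

Lemma axis_coord (r : nat) (i : 'I_r) (t : R) : axis i t i = t.
Proof. by rewrite /axis /upd eqxx. Qed.

Lemma msucc_axis_index (r : nat) (i : 'I_r) (k : nat) :
  msucc (axis_index i k) i = axis_index i k.+1.
Proof.
apply functional_extensionality => j; rewrite /axis_index /msucc.
by case: (j == i); rewrite ?addn1.
Qed.

Lemma mlen_axis_index (r : nat) (i : 'I_r) (k : nat) : mlen (axis_index i k) = k.
Proof.
rewrite /mlen /axis_index (bigD1 i) //= eqxx big1 ?addn0 // => j /negbTE ->.
by [].
Qed.

Lemma near_axis (r : nat) (i : 'I_r) (s t eps : R) :
  0 < eps -> Rabs (t - s) < eps -> near (axis i s) (axis i t) eps.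
Proof.
intros e0 H j; unfold axis, upd, origin.
destruct (j == i); [exact H|].
rewrite Rminus_diag Rabs_R0; exact e0.
Qed.

(** Heine-Borel by suprema: [E] collects the endpoints up to which the segment has a finite
    subcover. *)
Lemma axis_segment_compact (r : nat) (i : 'I_r) (d : R) :
  is_compact (fun x => exists t, 0 <= t <= d /\ x = axis i t).
Proof.
intros I O opO cov.
destruct (Rle_lt_dec 0 d) as [d0|dneg].
2:{ exists nil. intros x [t [Ht _]]; lra. }
pose (E := fun t => 0 <= t <= d /\ exists l : list I,
  forall s, 0 <= s <= t -> exists j, List.In j l /\ O j (axis i s)).
assert (E0 : E 0).
{ split; [lra|].
  destruct (cov (axis i 0)) as [j Hj]; [exists 0; split; [lra|reflexivity]|].
  exists (cons j nil). intros s Hs.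
  replace s with 0 by lra. exists j; split; [left; reflexivity|exact Hj]. }
destruct (completeness E) as [s [ub lub]].
{ exists d. intros t [Ht _]; lra. }
{ exists 0; exact E0. }
assert (s0 : 0 <= s) by (apply ub; exact E0).
assert (sd : s <= d) by (apply lub; intros t [Ht _]; lra).
destruct (cov (axis i s)) as [j Hj]; [exists s; split; [lra|reflexivity]|].
destruct (opO j _ Hj) as [eps [e0 Heps]].
assert (Ht : exists t, E t /\ s - eps < t).
{ apply NNPP; intros no.
  assert (s <= s - eps); [|lra].
  apply lub. intros t Et.
  destruct (Rle_lt_dec t (s - eps)) as [h|h]; [exact h|].
  exfalso; apply no; exists t; split; assumption. }
destruct Ht as [t [[Ht [l Hl]] st]].
(* Adding the open set around [axis i s] extends the cover beyond [s] unless [d] comes first; [s]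
   being an upper bound of [E], the minimum must be [d]. *)
assert (Em : E (Rmin d (s + eps / 2))).
{ assert (m1 := Rmin_l d (s + eps / 2)). assert (m2 := Rmin_r d (s + eps / 2)).
  assert (0 <= Rmin d (s + eps / 2)) by (apply Rmin_glb; lra).
  split; [lra|].
  exists (cons j l). intros v Hv.
  destruct (Rle_lt_dec v t) as [vt|tv].
  - destruct (Hl v ltac:(lra)) as [j' [Hj' Oj']].
    exists j'; split; [right; exact Hj'|exact Oj'].
  - exists j; split; [left; reflexivity|].
    apply Heps, near_axis; [exact e0|]. apply Rabs_def1; lra. }
assert (ms : Rmin d (s + eps / 2) <= s) by (apply ub; exact Em).
assert (md : Rmin d (s + eps / 2) = d).
{ unfold Rmin in *; destruct (Rle_dec d (s + eps / 2)); lra. }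
rewrite md in Em. destruct Em as [_ [l' Hl']].
exists l'. intros x [v [Hv ->]]. apply Hl'; exact Hv.
Qed.

Lemma jet_image_beurling_roumieu (r : nat) (M : R -> nat -> R) (b : mseq r) :
  jet_image false r M b -> jet_image true r M b.
Proof.
intros [U [f [D [oU [U0 [Df [nrm jet]]]]]]].
exists U, f, D. repeat (split; [assumption|]).
split; [|exact jet].
intros K cK KU. exists 1, 1. split; [lra|split; [lra|]].
apply nrm; [exact cK|exact KU|lra|lra].
Qed.

(** Reduces membership in the jet image to one variable, in exactly the form that the Bang and
    Bernstein arguments consume. *)
Lemma jet_image_axis (r : nat) (M : R -> nat -> R) (b : mseq r) (i : 'I_r) :
  weight_matrix M -> quasianalytic_matrix M -> jet_image true r M b ->
  exists (g : nat -> R -> R) (d : R) (W : nat -> R),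
    0 < d /\ derivative_tower g d /\
    (forall n t, 0 <= t <= d -> Rabs (g n t) <= W n) /\
    (forall n, 0 < W n) /\ ratio_increasing W /\ ratio_sum_diverges W /\
    (forall k, b (axis_index i k) = g k 0 / INR (Factorial.fact k)).
Proof.
intros [wM _] qM [U [f [D [oU [U0 [Df [nrm jet]]]]]]].
destruct (oU _ U0) as [eps [e0 Heps]].
assert (UA : forall t, 0 <= t <= eps / 2 -> U (axis i t)).
{ intros t Ht. apply Heps. rewrite <- (axis0 r i).
  apply near_axis; [exact e0|]. apply Rabs_def1; lra. }
destruct (nrm _ (@axis_segment_compact r i (eps / 2))) as [l [h [l0 [h0 [C HC]]]]].
{ intros x [t [Ht ->]]. apply UA; exact Ht. }
assert (Ml0 : forall p, 0 < M l p) by apply (wM l l0).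
(* The constant in [norm_finite] carries no sign; the maximum with 1 makes the weights positive. *)
assert (C1 : 0 < Rmax C 1) by (assert (H := Rmax_r C 1); lra).
assert (P0 : forall k, 0 < h ^ k * M l k).
{ intros k; apply Rmult_lt_0_compat; [apply pow_lt; exact h0|apply Ml0]. }
exists (fun k t => D (axis_index i k) (axis i t)), (eps / 2),
  (fun k => Rmax C 1 * (h ^ k * M l k)).
split; [lra|]. split.
{ intros n t Ht. destruct Df as [_ [Dd _]].
  assert (H := Dd (axis_index i n) i (axis i t) (UA t Ht)).
  rewrite msucc_axis_index axis_coord in H.
  replace (fun t => D (axis_index i n) (axis i t)) with
    (fun s => D (axis_index i n) (upd (axis i t) i s)); [exact H|].
  apply functional_extensionality => s; rewrite upd_axis; reflexivity. }
split.
{ intros n t Ht.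
  assert (H := HC (axis_index i n) (axis i t)
    (ex_intro _ t (conj Ht (erefl (axis i t))))).
  rewrite mlen_axis_index in H. apply Rle_trans with (1 := H).
  apply Rmult_le_compat_r; [apply Rlt_le, P0|apply Rmax_l]. }
split; [intros n; apply Rmult_lt_0_compat; [exact C1|apply P0]|].
split.
{ apply ratio_increasing_scale; [exact C1|exact h0|].
  apply log_convex_ratio_increasing, wM; exact l0. }
split.
{ apply ratio_sum_diverges_scale; [exact C1|exact h0|exact Ml0|].
  apply quasianalytic_ratio_sum_diverges; [exact Ml0|apply qM; exact l0]. }
intros k. rewrite jet mlen_axis_index axis0. reflexivity.
Qed.

(** The factor [s] of modulus one lets jets of eventually constant sign, positive or negative, be
    treated alike. *)
Lemma jet_image_signed_bound (r : nat) (M : R -> nat -> R) (b : mseq r)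
    (i : 'I_r) (s : R) (K : nat) :
  weight_matrix M -> quasianalytic_matrix M -> jet_image true r M b ->
  Rabs s = 1 ->
  (forall k, (K <= k)%N -> 0 < s * b (axis_index i k)) ->
  exists C R0, 0 < C /\ 0 < R0 /\
    forall k, (K <= k)%N -> s * b (axis_index i k) <= C * R0 ^ k.
Proof.
intros wM qM jb s1 pos.
destruct (@jet_image_axis r M b i wM qM jb)
  as [g [d [W [d0 [gD [g_le [W0 [Wr [Wd jet]]]]]]]]].
assert (dK := pow_lt d K d0).
exists (W K * d ^ K), (/ d).
split; [apply Rmult_lt_0_compat; [apply W0|exact dK]|].
split; [apply Rinv_0_lt_compat; exact d0|].
intros k Kk.
replace (s * b (axis_index i k)) with (s * g k 0 / INR (Factorial.fact k))
  by (rewrite jet; unfold Rdiv; ring).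
apply (@quasianalytic_positive_jet_bound (fun n t => s * g n t) d W);
  try assumption.
- intros n t Ht. apply derivable_pt_lim_scal, gD; exact Ht.
- intros n t Ht. rewrite Rabs_mult s1 Rmult_1_l. apply g_le; exact Ht.
- intros n Kn. assert (H := pos n Kn). rewrite jet in H.
  assert (fn := INR_fact_lt_0 n).
  replace (s * g n 0) with
    (s * (g n 0 / INR (Factorial.fact n)) * INR (Factorial.fact n))
    by (field; lra).
  apply Rmult_lt_0_compat; assumption.
Qed.

(** * Sequences outgrowing every geometric sequence *)

Definition superexponential (beta : nat -> R) : Prop :=
  forall A, 0 < A -> exists k, (1 <= k)%N /\ A ^ k < beta k.

Lemma eventually_le_scale (F G : nat -> R) (K : nat) :
  (forall k, 0 < G k) -> (forall k, (K <= k)%N -> F k <= G k) ->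
  exists C, 1 <= C /\ forall k, F k <= C * G k.
Proof.
intros G0 H.
assert (fin : forall n, exists C, 1 <= C /\ forall k, (k < n)%N -> F k <= C * G k).
{ induction n as [|n [C [C1 IH]]]; [exists 1; split; [lra|intros; lia]|].
  exists (Rmax C (F n / G n)).
  assert (m1 := Rmax_l C (F n / G n)). assert (m2 := Rmax_r C (F n / G n)).
  split; [lra|]. intros k kn.
  assert (Gk := G0 k).
  destruct (ltngtP k n) as [kn'|kn'|kn']; [|lia|].
  - apply Rle_trans with (1 := IH k kn').
    apply Rmult_le_compat_r; lra.
  - subst k. apply Rle_trans with (F n / G n * G n).
    + replace (F n / G n * G n) with (F n) by (field; lra). lra.
    + apply Rmult_le_compat_r; lra. }
destruct (fin K) as [C [C1 HC]].
exists C; split; [exact C1|]. intros k.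
destruct (ltnP k K) as [kK|kK]; [apply HC; exact kK|].
apply Rle_trans with (1 := H k kK). assert (Gk := G0 k); nra.
Qed.

(** Finitely many exceptional indices are absorbed into a constant, and the constant into the base:
    [B <= B ^ k] since [B >= 1] and [k >= 1]. *)
Lemma superexponential_unbounded (beta : nat -> R) (C R0 : R) (K : nat) :
  0 < C -> 0 < R0 -> superexponential beta ->
  ~ (forall k, (K <= k)%N -> beta k <= C * R0 ^ k).
Proof.
intros C0 R00 sup H.
assert (G0 : forall k, 0 < C * R0 ^ k).
{ intros k; apply Rmult_lt_0_compat; [exact C0|apply pow_lt; exact R00]. }
destruct (@eventually_le_scale beta (fun k => C * R0 ^ k) K G0 H) as [C' [C1 HC]].
pose (B := Rmax 1 (C' * C)).
assert (B1 : 1 <= B) by apply Rmax_l.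
assert (BC : C' * C <= B) by apply Rmax_r.
destruct (sup (B * R0)) as [k [k1 Hk]]; [nra|].
assert (Hb := HC k).
assert (Rk := pow_lt R0 k R00).
assert (B <= B ^ k).
{ rewrite -{1}(pow_1 B). apply Rle_pow; [exact B1|lia]. }
rewrite Rpow_mult_distr in Hk. nra.
Qed.

Lemma proot_lt_pow (A y : R) (k : nat) :
  0 < A -> 0 < y -> (1 <= k)%N -> A < proot k y -> A ^ k < y.
Proof.
intros A0 y0 k1 H.
assert (k0 : 0 < INR k) by (apply lt_0_INR; lia).
rewrite -Rpower_pow; [|exact A0].
replace y with (Rpower (proot k y) (INR k)).
- apply Rlt_Rpower_l; [exact k0|split; assumption].
- unfold proot. rewrite Rpower_mult Rinv_l; [|lra]. apply Rpower_1; exact y0.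
Qed.

(** * Sign and size of a polynomial near 0 *)

Lemma Rabs_normalize (c : R) : c <> 0 ->
  Rabs (c / Rabs c) = 1 /\ c / Rabs c * c = Rabs c.
Proof.
intros c0. assert (a0 := Rabs_pos_lt _ c0). split.
- unfold Rdiv. rewrite Rabs_mult Rabs_inv Rabs_Rabsolu Rinv_r; lra.
- assert (E : c * c = Rabs c * Rabs c)
    by (rewrite -Rabs_mult Rabs_right; [reflexivity|nra]).
  replace (c / Rabs c * c) with (c * c / Rabs c) by (field; lra).
  rewrite E. field; lra.
Qed.

(** Induction on the degree: a zero constant term allows a factor [x] to be split off, and a nonzero
    one dominates the rest for small [x]. *)
Lemma polynomial_dominant_term (n : nat) (c : nat -> R) :
  (exists i, (i <= n)%N /\ c i <> 0) ->
  exists s eta x0 i0, Rabs s = 1 /\ 0 < eta /\ 0 < x0 /\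
    forall x, 0 < x -> x <= x0 ->
      eta * x ^ i0 <= s * sum_f_R0 (fun i => c i * x ^ i) n.
Proof.
revert c; induction n as [|n IH]; intros c [j [jn cj]].
{ replace j with 0%N in cj by lia.
  exists (c 0%N / Rabs (c 0%N)), (Rabs (c 0%N)), 1, 0%N.
  assert (a0 := Rabs_pos_lt _ cj).
  destruct (Rabs_normalize _ cj) as [s1 sc].
  split; [exact s1|split; [exact a0|split; [lra|]]].
  intros x _ _; simpl. lra. }
assert (dec : forall x, sum_f_R0 (fun i => c i * x ^ i) n.+1 =
  c 0%N + x * sum_f_R0 (fun i => c i.+1 * x ^ i) n).
{ intros x. rewrite decomp_sum; [|lia]. simpl Init.Nat.pred.
  rewrite scal_sum. simpl pow at 1. rewrite Rmult_1_r. f_equal.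
  apply PartSum.sum_eq; intros i _; simpl; ring. }
destruct (Req_dec (c 0%N) 0) as [c0|c0].
- destruct (IH (fun i => c i.+1)) as [s [eta [x0 [i0 [s1 [e0 [x00 H]]]]]]].
  { destruct j as [|j]; [contradiction|]. exists j; split; [lia|exact cj]. }
  exists s, eta, x0, i0.+1. repeat (split; [assumption|]).
  intros x xp xx0. rewrite dec c0.
  assert (H' := H x xp xx0). simpl. nra.
- pose (B := sum_f_R0 (fun i => Rabs (c i.+1)) n + 1).
  assert (B0 : 1 <= B).
  { assert (0 <= sum_f_R0 (fun i => Rabs (c i.+1)) n)
      by (apply cond_pos_sum; intros; apply Rabs_pos).
    unfold B; lra. }
  assert (a0 := Rabs_pos_lt _ c0).
  (* For [x] below this threshold the remaining terms amount to at most half of the constant term;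
     the [+ 1] in [B] makes the division legitimate. *)
  exists (c 0%N / Rabs (c 0%N)), (Rabs (c 0%N) / 2),
    (Rmin 1 (Rabs (c 0%N) / 2 / B)), 0%N.
  destruct (Rabs_normalize _ c0) as [s1 E].
  assert (q0 : 0 < Rabs (c 0%N) / 2 / B) by (apply Rdiv_lt_0_compat; lra).
  split; [exact s1|]. split; [lra|].
  split; [apply Rmin_glb_lt; lra|].
  intros x xp xx0.
  assert (x1 : x <= 1) by (apply Rle_trans with (1 := xx0), Rmin_l).
  assert (xq : x <= Rabs (c 0%N) / 2 / B) by (apply Rle_trans with (1 := xx0), Rmin_r).
  rewrite dec. simpl. rewrite Rmult_1_r Rmult_plus_distr_l.
  rewrite E.
  set (S := sum_f_R0 _ n).
  assert (SB : Rabs S <= B).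
  { apply Rle_trans with (1 := Rsum_abs _ _).
    apply Rle_trans with (sum_f_R0 (fun i => Rabs (c i.+1)) n); [|unfold B; lra].
    apply sum_Rle. intros i _. rewrite Rabs_mult.
    assert (Rabs (x ^ i) <= 1).
    { rewrite -RPow_abs Rabs_right; [|lra].
      rewrite -(pow1 i). apply pow_incr; lra. }
    assert (H' := Rabs_pos (c i.+1)). nra. }
  assert (T : Rabs (c 0%N / Rabs (c 0%N) * (x * S)) <= Rabs (c 0%N) / 2).
  { rewrite Rabs_mult s1 Rmult_1_l Rabs_mult (Rabs_right x); [|lra].
    apply Rle_trans with (Rabs (c 0%N) / 2 / B * B).
    - apply Rmult_le_compat; [lra|apply Rabs_pos|exact xq|exact SB].
    - apply Req_le; field; lra. }
  assert (T' := Rle_abs (- (c 0%N / Rabs (c 0%N) * (x * S)))).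
  rewrite Rabs_Ropp in T'. lra.
Qed.

Lemma half_pow_small (x0 : R) : 0 < x0 ->
  exists K, forall k, (K <= k)%N -> (/ 2) ^ k <= x0.
Proof.
intros h.
destruct (pow_lt_1_zero (/ 2)) with (y := x0) as [K HK];
  [rewrite Rabs_right; lra|exact h|].
exists K. intros k Kk.
assert (H := HK k ltac:(lia)).
assert (H' := Rle_abs ((/ 2) ^ k)). lra.
Qed.

(** * Polynomial multiples of a fixed sequence and their span *)

Lemma sum_truncated (c e : nat -> R) (n m : nat) : (n <= m)%N ->
  sum_f_R0 (fun i => (if (i <= n)%N then c i else 0) * e i) m =
  sum_f_R0 (fun i => c i * e i) n.
Proof.
intros nm; replace m with (n + (m - n))%N by lia.
induction (m - n)%N as [|k IH].
- rewrite addn0. apply PartSum.sum_eq; intros i Hi.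
  replace (i <= n)%N with true by lia. reflexivity.
- rewrite addnS /= IH.
  replace ((n + k).+1 <= n)%N with false by lia. ring.
Qed.

Definition poly_multiple {r : nat} (beta : nat -> R) (n : nat) (c : nat -> R) :
    mseq r :=
  fun a => sum_f_R0 (fun i => c i * ((/ 2) ^ mlen a) ^ i) n * beta (mlen a).

Lemma poly_multiple_bound (r : nat) (beta : nat -> R) (n : nat) (c : nat -> R)
    (a : mindex r) :
  0 < beta (mlen a) ->
  Rabs (poly_multiple beta n c a) <=
    sum_f_R0 (fun i => Rabs (c i)) n * beta (mlen a).
Proof.
intros b0; unfold poly_multiple.
rewrite Rabs_mult (Rabs_right (beta _)); [|lra].
apply Rmult_le_compat_r; [lra|].
apply Rle_trans with (1 := Rsum_abs _ _), sum_Rle.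
intros i _. rewrite Rabs_mult.
assert (0 <= ((/ 2) ^ mlen a) ^ i <= 1).
{ rewrite -pow_mult. split; [apply pow_le; lra|].
  rewrite -(pow1 (mlen a * i)). apply pow_incr; lra. }
rewrite (Rabs_right (_ ^ i)); [|lra].
assert (H' := Rabs_pos (c i)). nra.
Qed.

(** At [x = 2 ^ (- |a|)] the lowest power [x ^ i0] equals [q ^ |a|] with [q = 2 ^ (- i0)], so it is
    only a geometric loss. *)
Lemma poly_multiple_dominant (r : nat) (beta : nat -> R) (n : nat) (c : nat -> R) :
  (forall k, 0 < beta k) -> (exists i, (i <= n)%N /\ c i <> 0) ->
  exists s eta q K, Rabs s = 1 /\ 0 < eta /\ 0 < q /\
    forall a : mindex r, (K <= mlen a)%N ->
      eta * q ^ mlen a * beta (mlen a) <= s * poly_multiple beta n c a.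
Proof.
intros b0 Hc.
destruct (polynomial_dominant_term n c Hc)
  as [s [eta [x0 [i0 [s1 [e0 [x00 H]]]]]]].
destruct (half_pow_small x0 x00) as [K HK].
exists s, eta, ((/ 2) ^ i0), K.
split; [exact s1|split; [exact e0|split; [apply pow_lt; lra|]]].
intros a Ka; unfold poly_multiple.
assert (H' := H ((/ 2) ^ mlen a) ltac:(apply pow_lt; lra) (HK _ Ka)).
rewrite -Rmult_assoc. apply Rmult_le_compat_r; [apply Rlt_le, b0|].
replace (((/ 2) ^ i0) ^ mlen a) with (((/ 2) ^ mlen a) ^ i0); [exact H'|].
rewrite -!pow_mult. f_equal. lia.
Qed.

Lemma nonzero_coefficient_dec (n : nat) (c : nat -> R) :
  (exists i, (i <= n)%N /\ c i <> 0) \/ (forall i, (i <= n)%N -> c i = 0).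
Proof.
destruct (classic (exists i, (i <= n)%N /\ c i <> 0)) as [h|h]; [left; exact h|].
right; intros i Hi. apply NNPP; intros ne; apply h; exists i; split; assumption.
Qed.

(** The space [X] enters only through containing all that [beta] dominates, so the Roumieu and
    Beurling cases share this argument. *)
Lemma lineable_of_superexponential (r : nat) (M : R -> nat -> R)
    (X : mseq r -> Prop) (beta : nat -> R) :
  (0 < r)%N -> weight_matrix M -> quasianalytic_matrix M ->
  (forall k, 0 < beta k) -> superexponential beta ->
  (forall u B, (forall a, Rabs (u a) <= B * beta (mlen a)) -> X u) ->
  lineable_in X (fun b => X b /\ ~ jet_image true r M b).
Proof.
intros r0 wM qM b0 sup bX.
pose (i := Ordinal r0).
assert (dom : forall n c, (exists j, (j <= n)%N /\ c j <> 0) ->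
  ~ jet_image true r M (poly_multiple beta n c)).
{ intros n c Hc jet.
  destruct (@poly_multiple_dominant r beta n c b0 Hc)
    as [s [eta [q [K [s1 [e0 [q0 H]]]]]]].
  assert (H' : forall k, (K <= k)%N -> eta * q ^ k * beta k <=
    s * poly_multiple beta n c (axis_index i k)).
  { intros k Kk. assert (E := H (axis_index i k)).
    rewrite mlen_axis_index in E. apply E; exact Kk. }
  destruct (@jet_image_signed_bound r M _ i s K wM qM jet s1)
    as [C [R0 [C0 [R00 HR]]]].
  { intros k Kk. apply Rlt_le_trans with (2 := H' k Kk).
    assert (qk := pow_lt q k q0). assert (bk := b0 k).
    repeat apply Rmult_lt_0_compat; assumption. }
  (* The lower bound [eta * q ^ k * beta k] and the upper bound [C * R0 ^ k] would make [beta]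
     geometrically bounded, with these constants. *)
  apply (@superexponential_unbounded beta (C / eta) (R0 / q) K);
    [apply Rdiv_lt_0_compat; assumption|apply Rdiv_lt_0_compat; assumption
    |exact sup|].
  intros k Kk.
  assert (H1 := H' k Kk). assert (H2 := HR k Kk).
  assert (qk := pow_lt q k q0).
  apply Rmult_le_reg_l with (eta * q ^ k); [apply Rmult_lt_0_compat; assumption|].
  apply Rle_trans with (C * R0 ^ k); [lra|].
  apply Req_le. unfold Rdiv. rewrite Rpow_mult_distr pow_inv. field.
  split; lra. }
exists (fun u => exists n c, forall a, u a = poly_multiple beta n c a).
split; [|split; [|split; [|split; [|split]]]].
- exists 0%N, (fun _ => 0). intros a; unfold poly_multiple; simpl; ring.
- intros u v [n [c Hu]] [m [e Hv]].
  (* Both coefficient lists are padded with zeros to a common length. *)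
  exists (n + m)%N, (fun j => (if (j <= n)%N then c j else 0) +
    (if (j <= m)%N then e j else 0)).
  intros a. rewrite Hu Hv. unfold poly_multiple.
  rewrite -(@sum_truncated c _ n (n + m) ltac:(lia)).
  rewrite -(@sum_truncated e _ m (n + m) ltac:(lia)).
  rewrite -Rmult_plus_distr_r -sum_plus. f_equal.
  apply PartSum.sum_eq; intros j _; ring.
- intros t u [n [c Hu]]. exists n, (fun j => t * c j).
  intros a. rewrite Hu. unfold poly_multiple.
  rewrite -Rmult_assoc scal_sum. f_equal.
  apply PartSum.sum_eq; intros j _; ring.
- intros u [n [c Hu]].
  apply (bX u (sum_f_R0 (fun j => Rabs (c j)) n)).
  intros a; rewrite Hu; apply poly_multiple_bound, b0.
- exists (fun n a => ((/ 2) ^ mlen a) ^ n * beta (mlen a)). split.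
  { intros n. exists n, (fun j => if j == n then 1 else 0).
    intros a; unfold poly_multiple; f_equal.
    destruct n as [|n]; [simpl; ring|].
    rewrite tech5 eqxx.
    replace (sum_f_R0 _ n) with 0; [ring|].
    rewrite -{1}(Rmult_0_l (INR n.+1)) -sum_cte.
    apply PartSum.sum_eq; intros j Hj.
    replace (j == n.+1) with false by lia. ring. }
  intros n c Hc.
  destruct (nonzero_coefficient_dec n c) as [nz|z]; [exfalso|exact z].
  destruct (@poly_multiple_dominant r beta n c b0 nz)
    as [s [eta [q [K [s1 [e0 [q0 H]]]]]]].
  (* A vanishing combination contradicts the strict positivity of the dominant term at this one
     multi-index. *)
  assert (H' := H (axis_index i K)). rewrite mlen_axis_index in H'.
  assert (H'' := H' (leqnn K)).
  replace (poly_multiple beta n c (axis_index i K)) with 0 in H''.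
  + assert (qk := pow_lt q K q0). assert (bk := b0 K).
    assert (0 < eta * q ^ K * beta K)
      by (repeat apply Rmult_lt_0_compat; assumption).
    lra.
  + unfold poly_multiple. rewrite -(Hc (axis_index i K)) Rmult_comm scal_sum.
    apply PartSum.sum_eq; intros j _; ring.
- intros u [n [c Hu]].
  assert (Eu : u = poly_multiple beta n c)
    by (apply functional_extensionality; exact Hu).
  destruct (nonzero_coefficient_dec n c) as [nz|z].
  + right. split.
    * apply (bX u (sum_f_R0 (fun j => Rabs (c j)) n)).
      intros a; rewrite Hu; apply poly_multiple_bound, b0.
    * rewrite Eu; apply dom; exact nz.
  + left. apply functional_extensionality; intros a.
    rewrite Hu. unfold poly_multiple.
    replace (sum_f_R0 _ n) with 0; [ring|].
    rewrite -{1}(Rmult_0_l (INR n.+1)) -sum_cte.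
    apply PartSum.sum_eq; intros j Hj.
    rewrite z; [ring|lia].
Qed.

(** * Superexponential sequences inside the target space *)

Lemma small_m_gt0 (N : R -> nat -> R) (l : R) (k : nat) :
  weight_matrix N -> 0 < l -> 0 < small_m (N l) k.
Proof.
intros [wN _] l0. apply Rdiv_lt_0_compat; [apply wN; exact l0|apply INR_fact_lt_0].
Qed.

Lemma small_m_le (N : R -> nat -> R) (l l' : R) (k : nat) :
  weight_matrix N -> 0 < l -> l <= l' -> small_m (N l) k <= small_m (N l') k.
Proof.
intros [_ mN] l0 ll'. apply Rmult_le_compat_r.
- apply Rlt_le, Rinv_0_lt_compat, INR_fact_lt_0.
- apply mN; assumption.
Qed.

Lemma superexponential_roumieu (N : R -> nat -> R) :
  weight_matrix N -> growth_condition true N -> superexponential (small_m (N 1)).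
Proof.
intros wN gr A A0.
destruct (gr 1 Rlt_0_1 A) as [k [k1 Hk]].
exists k; split; [exact k1|].
apply proot_lt_pow; [exact A0|apply small_m_gt0; [exact wN|lra]|exact k1|exact Hk].
Qed.

Fixpoint prefix_min (F : nat -> R) (n : nat) : R :=
  if n is p.+1 then Rmin (prefix_min F p) (F n) else F 0%N.

Lemma prefix_min_le (F : nat -> R) (n j : nat) :
  (j <= n)%N -> prefix_min F n <= F j.
Proof.
induction n as [|n IH]; intros jn; simpl.
- replace j with 0%N by lia. lra.
- destruct (ltngtP j n.+1) as [h|h|h]; [|lia|].
  + apply Rle_trans with (1 := Rmin_l _ _), IH; lia.
  + rewrite h; apply Rmin_r.
Qed.

Lemma prefix_min_gt (F : nat -> R) (n : nat) (A : R) :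
  (forall j, (j <= n)%N -> A < F j) -> A < prefix_min F n.
Proof.
induction n as [|n IH]; intros H; simpl; [apply H; lia|].
apply Rmin_glb_lt; [apply IH; intros j jn; apply H; lia|apply H; lia].
Qed.

(* A diagonal minimum of the countably many weights [h ^ k * n_k^(h)],
   [h = 1 / (j + 1)], each rescaled so as to dominate [(j + 1) ^ k]. *)
Lemma beurling_superexponential_minorant (N : R -> nat -> R) :
  weight_matrix N -> growth_condition false N ->
  exists beta, (forall k, 0 < beta k) /\ superexponential beta /\
    forall l h, 0 < l -> 0 < h ->
      exists C, 0 <= C /\ forall k, beta k <= C * (h ^ k * small_m (N l) k).
Proof.
intros wN gr.
pose (h j := / INR j.+1).
assert (S0 : forall j, 0 < INR j.+1) by (intros j; apply lt_0_INR; lia).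
assert (h0 : forall j, 0 < h j) by (intros j; apply Rinv_0_lt_compat, S0).
pose (w j k := h j ^ k * small_m (N (h j)) k).
assert (w0 : forall j k, 0 < w j k).
{ intros j k; apply Rmult_lt_0_compat; [apply pow_lt, h0|].
  apply small_m_gt0; [exact wN|apply h0]. }
assert (hle : forall i j, (i <= j)%N -> h j <= h i).
{ intros i j ij. apply Rinv_le_contravar; [apply S0|apply le_INR; lia]. }
assert (wle : forall i j k, (i <= j)%N -> w j k <= w i k).
{ intros i j k ij.
  apply Rmult_le_compat; [apply pow_le, Rlt_le, h0| | |].
  - apply Rlt_le, small_m_gt0; [exact wN|apply h0].
  - apply pow_incr. split; [apply Rlt_le, h0|apply hle; exact ij].
  - apply small_m_le; [exact wN|apply h0|apply hle; exact ij]. }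
assert (wbig : forall j A, 0 < A -> exists K, forall k, (K <= k)%N ->
  (1 <= k)%N -> A ^ k < w j k).
{ intros j A A0.
  destruct (gr (h j) (h0 j) (A * INR j.+1)) as [K HK].
  exists K. intros k Kk k1.
  assert (H := @proot_lt_pow (A * INR j.+1) (small_m (N (h j)) k) k
    ltac:(apply Rmult_lt_0_compat; [exact A0|apply S0])
    (@small_m_gt0 N (h j) k wN (h0 j)) k1 (HK k Kk k1)).
  rewrite Rpow_mult_distr in H.
  assert (hk := pow_lt _ k (h0 j)).
  replace (A ^ k) with (h j ^ k * (A ^ k * INR j.+1 ^ k)).
  - apply Rmult_lt_compat_l; assumption.
  - unfold h; rewrite pow_inv. field. apply pow_nonzero, Rgt_not_eq, S0. }
assert (scale : forall j, exists C, 1 <= C /\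
  forall k, INR j.+1 ^ k <= C * w j k).
{ intros j. destruct (wbig j (INR j.+1) (S0 j)) as [K HK].
  apply (@eventually_le_scale (fun k => INR j.+1 ^ k) (w j) (maxn K 1));
    [apply w0|].
  intros k Kk. apply Rlt_le, HK; lia. }
pose (c j := proj1_sig (constructive_indefinite_description _ (scale j))).
assert (Hc : forall j, 1 <= c j /\ forall k, INR j.+1 ^ k <= c j * w j k).
{ intros j; unfold c.
  destruct (constructive_indefinite_description _ (scale j)) as [C HC]; exact HC. }
(* At index [k] only the weights with [j <= k] compete: the minimum is finite, yet each fixed weight
   takes part from [k = j] on. *)
exists (fun k => prefix_min (fun j => c j * w j k) k).
split; [|split].
- intros k. apply prefix_min_gt. intros j _.
  apply Rmult_lt_0_compat; [|apply w0].
  assert (H := proj1 (Hc j)); lra.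
- intros A A0.
  destruct (INR_unbounded A) as [m Hm].
  destruct (wbig m A A0) as [K HK].
  exists (maxn K 1). split; [lia|].
  set (k := maxn K 1).
  apply prefix_min_gt. intros j _.
  destruct (Hc j) as [c1 ck].
  (* For [j >= m] the rescaling gives at least [(j + 1) ^ k > A ^ k]; the weights with [j < m] lie
     above [w m], which exceeds [A ^ k] by the choice of [k]. *)
  destruct (leqP m j) as [mj|jm].
  + apply Rlt_le_trans with (2 := ck k).
    assert (k0 : 0 < INR k) by (apply lt_0_INR; unfold k; lia).
    rewrite -!Rpower_pow; [|apply S0|exact A0].
    apply Rlt_Rpower_l; [exact k0|]. split; [exact A0|].
    apply Rlt_le_trans with (1 := Hm), le_INR; lia.
  + apply Rlt_le_trans with (w m k); [apply HK; unfold k; lia|].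
    apply Rle_trans with (w j k); [apply wle; lia|].
    assert (H := w0 j k); nra.
- intros l h' l0 h'0.
  (* A single [j] with [1 / (j + 1)] below both [l] and [h'] suffices, by monotonicity in each
     parameter. *)
  destruct (INR_unbounded (/ Rmin l h')) as [j Hj].
  assert (m0 : 0 < Rmin l h') by (apply Rmin_glb_lt; assumption).
  assert (hm : h j <= Rmin l h').
  { rewrite -(Rinv_inv (Rmin l h')). apply Rinv_le_contravar.
    - apply Rinv_0_lt_compat; exact m0.
    - apply Rlt_le, Rlt_le_trans with (1 := Hj), le_INR; lia. }
  assert (hl : h j <= l) by (apply Rle_trans with (1 := hm), Rmin_l).
  assert (hh : h j <= h') by (apply Rle_trans with (1 := hm), Rmin_r).
  destruct (Hc j) as [c1 ck].
  destruct (@eventually_le_scale (fun k => prefix_min (fun j => c j * w j k) k)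
    (fun k => c j * w j k) j) as [C [C1 HC]].
  { intros k; apply Rmult_lt_0_compat; [lra|apply w0]. }
  { intros k jk. apply (@prefix_min_le (fun j => c j * w j k)); exact jk. }
  exists (C * c j). split; [nra|].
  intros k. apply Rle_trans with (1 := HC k).
  rewrite -Rmult_assoc. apply Rmult_le_compat_l; [nra|].
  apply Rmult_le_compat; [apply pow_le, Rlt_le, h0| | |].
  + apply Rlt_le, small_m_gt0; [exact wN|apply h0].
  + apply pow_incr. split; [apply Rlt_le, h0|exact hh].
  + apply small_m_le; [exact wN|apply h0|exact hl].
Qed.

Lemma Lambda_superexponential_minorant (roumieu : bool) (r : nat)
    (N : R -> nat -> R) :
  weight_matrix N -> growth_condition roumieu N ->
  exists beta, (forall k, 0 < beta k) /\ superexponential beta /\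
    forall u B, (forall a, Rabs (u a) <= B * beta (mlen a)) ->
      Lambda roumieu r N u.
Proof.
destruct roumieu; intros wN gr.
- exists (small_m (N 1)).
  split; [intros k; apply small_m_gt0; [exact wN|lra]|].
  split; [apply superexponential_roumieu; assumption|].
  intros u B Hu. exists 1, 1, B. split; [lra|split; [lra|]].
  intros a; rewrite pow1 Rmult_1_l; apply Hu.
- destruct (beurling_superexponential_minorant N wN gr) as [beta [b0 [sup Hb]]].
  exists beta. split; [exact b0|split; [exact sup|]].
  intros u B Hu l h l0 h0.
  destruct (Hb l h l0 h0) as [C [C0 HC]].
  (* [B] may be negative, and multiplying the bound on [beta] needs a nonnegative factor. *)
  exists (Rabs B * C). intros a.
  apply Rle_trans with (1 := Hu a).
  apply Rle_trans with (Rabs B * beta (mlen a)).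
  + apply Rmult_le_compat_r; [apply Rlt_le, b0|apply Rle_abs].
  + rewrite Rmult_assoc. apply Rmult_le_compat_l; [apply Rabs_pos|apply HC].
Qed.

Lemma lineable_in_sub (r : nat) (X L L' : mseq r -> Prop) :
  (forall u, L u -> L' u) -> lineable_in X L -> lineable_in X L'.
Proof.
intros LL' [V [V0 [VD [VZ [VX [Vi VL]]]]]].
exists V. repeat (split; [assumption|]).
intros u Vu; destruct (VL u Vu) as [e|h]; [left; exact e|right; apply LL', h].
Qed.

(* roumieu = true : Roumieu case [.] = {.};  roumieu = false : Beurling case [.] = (.) *)
Theorem mainTheorem14 (roumieu : bool) (r : nat) (M N : R -> nat -> R) :
  (0 < r)%nat ->
  weight_matrix M -> quasianalytic_matrix M ->
  weight_matrix N -> quasianalytic_matrix N ->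
  growth_condition roumieu N ->
  lineable_in (Lambda roumieu r N)
    (fun b => Lambda roumieu r N b /\ ~ jet_image true r M b) /\
  lineable_in (Lambda roumieu r N)
    (fun b => Lambda roumieu r N b /\ ~ jet_image false r M b).
Proof.
intros r0 wM qM wN _ gr.
destruct (@Lambda_superexponential_minorant roumieu r N wN gr)
  as [beta [b0 [sup bL]]].
assert (main := @lineable_of_superexponential r M (Lambda roumieu r N) beta
  r0 wM qM b0 sup bL).
split; [exact main|].
apply: lineable_in_sub main => u [Lu nj].
split; [exact Lu|]. intros jet; apply nj, jet_image_beurling_roumieu, jet.
Qed.
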